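(* Let $D=(\{x\},Y,A)$ be an oriented split graph with independent part consisting of the single vertex $x$. If $D$ is source-free (every vertex has at least one in-neighbour), then $D$ has a 2-king belonging to $Y$.
   Context: An oriented split graph $D=(X,Y,A)$ is an oriented graph (loopless, no pair of opposite arcs) whose vertex set is partitioned into $X$ and $Y$ with $X$ independent and $D[Y]$ a tournament. For a vertex $u$: $N^+(u)=\{v:uv\in A\}$, $N^{++}(u)=\{v: uw,wv\in A\text{ for some } w\}\setminus N^+(u)$. A vertex $u$ is a 2-king of $D$ if $V(D)=\{u\}\cup N^+(u)\cup N^{++}(u)$. *)

(* Defs.v *)
From mathcomp Require Import all_boot.

Set Implicit Arguments.
Unset Strict Implicit.
Unset Printing Implicit Defensive.

(* A finite digraph is a finType V of vertices with an arc relation A : rel V. *)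

Definition outN (V : finType) (A : rel V) (u : V) : {set V} := [set v | A u v].

Definition outN2 (V : finType) (A : rel V) (u : V) : {set V} :=
  [set v | [exists w, A u w && A w v]] :\: outN A u.

Definition two_king (V : finType) (A : rel V) (u : V) : Prop :=
  [set: V] = [set u] :|: outN A u :|: outN2 A u.

Definition oriented (V : finType) (A : rel V) : Prop :=
  irreflexive A /\ (forall u v : V, ~~ (A u v && A v u)).

Definition independent (V : finType) (A : rel V) (X : {set V}) : Prop :=
  {in X &, forall u v, ~~ A u v}.

Definition induces_tournament (V : finType) (A : rel V) (Y : {set V}) : Prop :=
  {in Y, forall u, ~~ A u u} /\
  {in Y &, forall u v, u != v -> A u v (+) A v u}.

Definition oriented_split_graph (V : finType) (X Y : {set V}) (A : rel V)
  : Prop :=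
  [/\ oriented A,
      X :|: Y = [set: V],
      [disjoint X & Y],
      independent A X
    & induces_tournament A Y].

Definition source_free (V : finType) (A : rel V) : Prop :=
  forall v : V, exists u : V, A u v.

(* Main.v *)
Require Import Defs.
From mathcomp Require Import all_boot.

(** Let y have the largest out-degree inside Y among the vertices of Y that
    reach x in at most two steps.  A vertex u of Y not reached by y in at most
    two steps would dominate y and all out-neighbours of y in Y; hence it
    reaches x in at most two steps as well, and its out-degree inside Y is
    larger, a contradiction. *)

Definition reach2 {V : finType} (A : rel V) (u v : V) : bool :=
  A u v || [exists w, A u w && A w v].

Lemma two_kingP (V : finType) (A : rel V) (u : V) :
  (forall v, v != u -> reach2 A u v) -> two_king A u.
Proof.
move=> reach; apply/setP => v; rewrite !inE.
have [//|/reach] := eqVneq v u.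
by rewrite /reach2; case: (A u v).
Qed.

(** An arc from [w] to [u] would complete a two-step path from [y] to [u], so the tournament arc
    between them leaves [u]. *)
Lemma tournament_dominates {V : finType} {A : rel V} {Y : {set V}} {y u : V} :
  induces_tournament A Y -> y \in Y -> u \in Y -> u != y ->
  ~~ reach2 A y u ->
  A u y /\ {in Y, forall w, A y w -> A u w}.
Proof.
move=> [_ tour] yY uY uy; rewrite negb_or negb_exists => /andP[nyu /forallP nW].
split=> [|w wY yw].
  by have := tour u y uY yY uy; rewrite (negbTE nyu) addbF.
have nwu : ~~ A w u by have := nW w; rewrite yw.
have uw : u != w by apply: contraNneq nyu => ->.
by have := tour u w uY wY uw; rewrite (negbTE nwu) addbF.
Qed.

Theorem theorem4p3 (V : finType) (x : V) (Y : {set V}) (A : rel V)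
  (hD : oriented_split_graph [set x] Y A)
  (hsf : source_free A) :
  exists y : V, y \in Y /\ two_king A y.
Proof.
case: hD => [[irrA _] XY _ _ tourY].
have inY v : v != x -> v \in Y.
  by move=> /negbTE vx; move/setP/(_ v): XY; rewrite !inE vx.
(* Source-freeness at [x] supplies a first candidate for the maximum. *)
have [z zx] := hsf x.
have zY : z \in Y by apply: inY; apply: contraTneq zx => ->; rewrite irrA.
pose good u := (u \in Y) && reach2 A u x.
have good_z : good z by rewrite /good zY /reach2 zx.
pose deg u := #|Y :&: outN A u|.
have [y /andP[yY yx] deg_max] := @arg_maxnP _ z good deg good_z.
exists y; split=> //; apply: two_kingP => u uy.
have [->//|/inY uY] := eqVneq u x.
apply/negPn/negP => nyu.
have [uAy dom] := tournament_dominates tourY yY uY uy nyu.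
have good_u : good u.
  rewrite /good uY /=; apply/orP; right; apply/existsP.
  (* The midpoint from [u] to [x] is [y] itself, or the midpoint [w] that [y] uses, which [u]
     dominates. *)
  case/orP: yx => [yx|/existsP[w /andP[yw wx]]]; first by exists y; rewrite uAy.
  have wY : w \in Y by apply: inY; apply: contraTneq wx => ->; rewrite irrA.
  by exists w; rewrite dom.
have: deg u <= deg y := deg_max u good_u; rewrite /deg leqNgt => /negP; apply.
apply: proper_card; apply/properP; split.
  by apply/subsetP => w; rewrite !inE => /andP[wY /(dom w wY) ->]; rewrite wY.
(* Strictness: [y] is an out-neighbour of [u] but not of itself. *)
by exists y; rewrite !inE ?uAy yY ?irrA.
Qed.
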